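(* Every sequential Thiele rule other than approval voting (AV), and every divisor method based on majoritarian portioning other than AV, fails strategyproofness for unrepresented voters for some committee size $k$, number of parties $m$, and number of voters $n$.
   Context: Setting. $N=\{1,\dots,n\}$ is a set of $n$ voters and $\mathcal P$ a set of $m$ parties. An approval ballot is a non-empty subset of $\mathcal P$; $\mathcal A$ is the set of all approval ballots. An approval profile is $A=(A_1,\dots,A_n)\in\mathcal A^n$, where $A_i$ is the ballot of voter $i$. A committee of size $k$ is a multiset of parties of total size $k$, i.e. a function $W:\mathcal P\to\{0,1,2,\dots\}$ with $\sum_{x\in\mathcal P}W(x)=k$; write $W(X)=\sum_{x\in X}W(x)$ for $X\subseteq\mathcal P$, and let $\mathcal W_k$ be the set of all committees of size $k$. A party-approval rule $f$ maps each profile $A\in\mathcal A^n$ and committee size $k$ to a single committee $f(A,k)\in\mathcal W_k$. Write $f(A,k,x)$ for the number of seats of $x$ in $f(A,k)$ and $f(A,k,X)=\sum_{x\in X}f(A,k,x)$. The rules below are defined for all $k,m,n\ge 1$. For each set of parties a linear order $\succ_1$ on the parties is fixed (independent of the profile), and whenever a rule is tied between several parties in a step, the $\succ_1$-best of them is selected. Sequential Thiele rules. Let $w=(w_1,w_2,\dots)$ be an infinite non-increasing sequence of non-negative reals with $w_1=1$, and let $s_w(W,A)=\sum_{i\in N}\sum_{j=1}^{W(A_i)}w_j$ for a committee $W$ of any size. The sequential $w$-Thiele rule starts with the empty committee and, in each of $k$ rounds, adds one seat for the party that increases the score $s_w$ of the current committee the most. Divisor methods based on majoritarian portioning. First, majoritarian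 portioning computes a weight $w_x$ for each party $x$: in each round, determine the party $x$ approved by the most remaining voters, set $w_x$ to the number of remaining voters approving $x$, and remove all these voters; repeat until no voters are left; every party that received no weight in this process gets $w_x=0$. Then, given a monotone function $g:\mathbb N_0\to\mathbb R_{>0}$ specifying the method, the $k$ seats are assigned in $k$ rounds: in the $i$-th round the next seat goes to the party $x$ maximizing $\frac{w_x}{g(t^x_{i-1})}$, where $t^x_{i-1}$ is the number of seats assigned to $x$ in the previous $i-1$ rounds. AV is the rule that assigns all $k$ seats to a party approved by the most voters (ties broken by $\succ_1$); it is the sequential Thiele rule with $w=(1,1,1,\dots)$. A rule is ''other than AV'' if it does not coincide with AV on all inputs (over all $k,m,n$). Strategyproofness for unrepresented voters (for given $k,m,n$): $f(A,k,A_i)\geq f(A',k,A_i)$ for all profiles $A,A'$ and voters $i\in N$ such that $A_j=A'_j$ for all $j\in N\setminus\{i\}$ and $f(A,k,A_i)=0$. *)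

(* Defs.v *)
From HB Require Import structures.
From mathcomp Require Import all_boot all_order all_algebra.
From mathcomp Require Import reals.
Set Implicit Arguments.
Unset Strict Implicit.
Unset Printing Implicit Defensive.
Import Order.TTheory GRing.Theory Num.Theory.
Local Open Scope ring_scope.

Definition ballot (P : finType) := {B : {set P} | B != set0}.

Definition profile (P : finType) (n : nat) := {ffun 'I_n -> ballot P}.

(* A committee of size [k] is a multiset whose values sum to [k]; the rules
   below return such committees by [sum_AV] and [sum_assign_seats]. *)
Definition multiset (P : finType) := {ffun P -> nat}.

Definition seats (P : finType) (W : multiset P) (X : {set P}) : nat :=
  (\sum_(x in X) W x)%N.

Definition strict_linear_order (T : eqType) (succ : rel T) : Prop :=
  [/\ irreflexive succ, transitive succ &
      forall x y : T, x != y -> succ x y || succ y x].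

(* The maximizer of [v], ties being resolved in favour of the [succ]-best
   maximizer; it is [None] only when [P] is empty (see [best_Some]). *)
Definition best (P : finType) (succ : rel P) (d : Order.disp_t)
    (T : orderType d) (v : P -> T) : option P :=
  [pick x | [forall y, (v y <= v x)%O &&
                       ((v y == v x) && (y != x) ==> succ x y)]].

Definition add_seat (P : finType) (x : P) (W : multiset P) : multiset P :=
  [ffun y => (W y + (y == x))%N].

Definition assign_seats (P : finType) (succ : rel P) (d : Order.disp_t)
    (T : orderType d) (priority : multiset P -> P -> T) (k : nat)
    : multiset P :=
  iter k (fun W => if best succ (priority W) is Some x then add_seat x W else W)
       [ffun=> 0%N].

Definition supporters (P : finType) (n : nat) (A : profile P n)
    (V : {set 'I_n}) (x : P) : {set 'I_n} :=
  [set i in V | x \in val (A i)].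

Definition AV (P : finType) (succ : rel P) (n : nat) (A : profile P n)
    (k : nat) : multiset P :=
  let winner := best succ (fun x => #|supporters A [set: 'I_n] x|) in
  [ffun x => if winner == Some x then k else 0%N].

(* [w j] is the weight of the [j]-th seat for [j >= 1]; [w 0] is never used. *)
Definition thiele_weights (R : realType) (w : nat -> R) : Prop :=
  [/\ w 1%N = 1,
      forall j : nat, (1 <= j)%N -> 0 <= w j &
      forall i j : nat, (1 <= i)%N -> (i <= j)%N -> w j <= w i].

Definition thiele_score (R : realType) (w : nat -> R) (P : finType) (n : nat)
    (A : profile P n) (W : multiset P) : R :=
  \sum_(i < n) \sum_(1 <= j < (seats W (val (A i))).+1) w j.

Definition seq_thiele (R : realType) (w : nat -> R) (P : finType)
    (succ : rel P) (n : nat) (A : profile P n) (k : nat) : multiset P :=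
  assign_seats succ
    (fun W x => thiele_score w A (add_seat x W) - thiele_score w A W) k.

(* [t] bounds the number of rounds, [V] is the set of remaining voters and
   [wt] the weights computed so far. *)
Fixpoint portioning_rounds (P : finType) (succ : rel P) (n : nat)
    (A : profile P n) (t : nat) (V : {set 'I_n}) (wt : {ffun P -> nat})
    : {ffun P -> nat} :=
  if t is t'.+1 then
    if V == set0 then wt else
    if best succ (fun x => #|supporters A V x|) is Some x then
      portioning_rounds succ A t' (V :\: supporters A V x)
        [ffun y => if y == x then #|supporters A V x| else wt y]
    else wt
  else wt.

(* Ballots are non-empty, so every round removes at least one voter and [n]
   rounds exhaust all of them (see [sum_majoritarian_portioning]). *)
Definition majoritarian_portioning (P : finType) (succ : rel P) (n : nat)
    (A : profile P n) : {ffun P -> nat} :=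
  portioning_rounds succ A n [set: 'I_n] [ffun=> 0%N].

Definition divisor_function (R : realType) (g : nat -> R) : Prop :=
  (forall t : nat, 0 < g t) /\ (forall s t : nat, (s <= t)%N -> g s <= g t).

Definition majoritarian_divisor (R : realType) (g : nat -> R) (P : finType)
    (succ : rel P) (n : nat) (A : profile P n) (k : nat) : multiset P :=
  assign_seats succ
    (fun W x => (majoritarian_portioning succ A x)%:R / g (W x)) k.

Definition rule := forall m n : nat, profile 'I_m n -> nat -> multiset 'I_m.

Definition coincide (f f' : rule) : Prop :=
  forall (m n k : nat), (1 <= m)%N -> (1 <= n)%N -> (1 <= k)%N ->
    forall A : profile 'I_m n, f m n A k = f' m n A k.

Definition sp_unrepresented (f : rule) (k m n : nat) : Prop :=
  forall (A A' : profile 'I_m n) (i : 'I_n),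
    (forall j : 'I_n, j != i -> A j = A' j) ->
    seats (f m n A k) (val (A i)) = 0%N ->
    (seats (f m n A k) (val (A i)) >= seats (f m n A' k) (val (A i)))%N.

Lemma best_Some (P : finType) (succ : rel P) (d : Order.disp_t)
    (T : orderType d) (v : P -> T) :
  strict_linear_order succ -> (0 < #|P|)%N -> exists x, best succ v = Some x.
Proof.
move=> [irr tr tot] /card_gt0P [x0 _].
pose r := [rel x y | (v y < v x)%O || ((v y == v x) && ((y == x) || succ x y))].
have rtr : transitive r.
  move=> y x z /=.
  case/orP=> [ltyx|/andP[/eqP -> hxy]]; case/orP=> [ltzy|/andP[/eqP -> hyz]].
  - by rewrite (lt_trans ltzy ltyx).
  - by rewrite ltyx.
  - by rewrite ltzy.
  - rewrite eqxx /=; apply/orP; right.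
    case/orP: hxy => [/eqP<-|hxy] //; case/orP: hyz => [/eqP->|hyz].
      by rewrite hxy orbT.
    by rewrite (tr _ _ _ hxy hyz) orbT.
have rtot : total r.
  move=> x y /=; case: ltgtP => //= _.
  by case: (eqVneq x y) => //= /tot.
have rrefl : reflexive r by move=> x /=; rewrite !eqxx orbT.
have [x _ xmax] := @extremumP _ _ r x0 predT id rrefl rtr rtot isT.
rewrite /best; case: pickP => [y _|/(_ x)/negP[]]; first by exists y.
apply/forallP => y; case/orP: (xmax y isT) => [lt_yx|/andP[/eqP -> hxy]].
  by rewrite (ltW lt_yx) (lt_eqF lt_yx).
by rewrite lexx eqxx /=; apply/implyP => nyx; move: hxy; rewrite (negPf nyx).
Qed.

Lemma sum_assign_seats (P : finType) (succ : rel P) (d : Order.disp_t)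
    (T : orderType d) (priority : multiset P -> P -> T) (k : nat) :
  strict_linear_order succ -> (0 < #|P|)%N ->
  (\sum_x assign_seats succ priority k x)%N = k.
Proof.
move=> lin P_gt0; rewrite /assign_seats; elim: k => [|k IHk] /=.
  by rewrite big1 // => x _; rewrite ffunE.
set W := iter _ _ _ in IHk *.
have [x ->] := best_Some (priority W) lin P_gt0.
under eq_bigr => y _ do rewrite ffunE.
rewrite big_split /= IHk (bigD1 x) //= eqxx big1 ?addn1 // => y.
by move/negPf->.
Qed.

Lemma sum_AV (P : finType) (succ : rel P) (n : nat) (A : profile P n)
    (k : nat) :
  strict_linear_order succ -> (0 < #|P|)%N ->
  (\sum_x AV succ A k x)%N = k.
Proof.
move=> lin P_gt0; rewrite /AV.
have [x ->] := best_Some (fun x => #|supporters A setT x|) lin P_gt0.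
rewrite (bigD1 x) //= ffunE eqxx big1 ?addn0 // => y /negPf nyx.
by rewrite ffunE; case: eqP => // -[xy]; rewrite xy eqxx in nyx.
Qed.

Lemma sum_majoritarian_portioning (P : finType) (succ : rel P) (n : nat)
    (A : profile P n) :
  strict_linear_order succ -> (0 < #|P|)%N ->
  (\sum_x majoritarian_portioning succ A x)%N = n.
Proof.
move=> lin P_gt0; rewrite /majoritarian_portioning.
suff H t (V : {set 'I_n}) (wt : {ffun P -> nat}) : (#|V| <= t)%N ->
    (forall x, (0 < wt x)%N -> supporters A V x = set0) ->
    (\sum_x portioning_rounds succ A t V wt x = \sum_x wt x + #|V|)%N.
  rewrite H ?cardsT ?card_ord // => [|x]; last by rewrite ffunE.
  by rewrite big1 // => x _; rewrite ffunE.
elim: t V wt => [|t IHt] V wt leVt wt0 /=.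
  by move: leVt; rewrite leqn0 => /eqP->; rewrite addn0.
have [->|V0] := eqVneq V set0; first by rewrite cards0 addn0.
have [x bx] := best_Some (fun x => #|supporters A V x|) lin P_gt0.
rewrite bx; move: bx; rewrite /best; case: pickP => // x' /forallP xmax [xx'].
rewrite {x'}xx' in xmax; set S := supporters A V x.
have S_gt0 : (0 < #|S|)%N.
  have /set0Pn[i iV] := V0; have /set0Pn[y yA] := valP (A i).
  have /andP[le_yx _] := xmax y; apply: (leq_trans _ le_yx).
  by apply/card_gt0P; exists i; rewrite inE iV.
have SV : S \subset V by apply/subsetP => i; rewrite inE => /andP[].
have cVS : (#|V :\: S| + #|S| = #|V|)%N.
  by rewrite -[in RHS](cardsID S V) addnC (setIidPr SV).
have wtx : wt x = 0%N.
  by case: (posnP (wt x)) => // /wt0 S0; move: S_gt0; rewrite /S S0 cards0.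
rewrite IHt.
- rewrite -cVS (bigD1 x) //= [in RHS](bigD1 x) //= ffunE eqxx wtx add0n.
  rewrite (eq_bigr wt) => [|y /negPf nyx]; last by rewrite ffunE nyx.
  by rewrite [RHS]addnA [RHS]addnC addnA.
- by rewrite -ltnS; apply: leq_trans leVt; rewrite -cVS -addn1 leq_add2l.
move=> y; rewrite ffunE; have [->|_] := eqVneq y x => [_|/wt0 S0].
  by apply/setP => i; rewrite !inE; case: (i \in V) => //=; rewrite ?andbF // andbT andNb.
apply/setP => i; have /setP/(_ i) := S0; rewrite !inE.
by case: (i \in V) => //= ->; rewrite andbF.
Qed.

(* Main.v *)
(** Let [c < 1] be the relative value of the first seat that is discounted: all
    earlier seats go to the approval winner, and in the next round its voters
    count only with factor [c].  Take three parties with [x] preferred to [y],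
    and ballots [{a}] ([t + 1] times), [{x, y}], [{x, a}], [{y}] ([t + 2] times
    each).  Parties [x] and [y] tie, [x] wins, and [a] is weakened by the
    overlap with [x], so that [y] is ahead of [a].  If one voter of [a] reports
    [{y}] instead, then [y] wins, which weakens [x] but not [a], and the
    discounted seat goes to [a] as soon as [c (t + 2) < t].  The same profiles
    serve both families of rules. *)

Require Import Defs.
From HB Require Import structures.
From mathcomp Require Import all_boot all_order all_algebra.
From mathcomp Require Import reals.
From mathcomp Require Import boolp.
From mathcomp Require Import zify lra.
Set Implicit Arguments.
Unset Strict Implicit.
Unset Printing Implicit Defensive.
Import Order.TTheory GRing.Theory Num.Theory.
Local Open Scope ring_scope.

(** * Maximizers with tie-breaking *)

Lemma best_SomeP (P : finType) (succ : rel P) (d : Order.disp_t)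
    (T : orderType d) (v : P -> T) (x : P) :
  strict_linear_order succ ->
  best succ v = Some x <->
  (forall y, (v y <= v x)%O /\ (v y = v x -> y != x -> succ x y)).
Proof.
move=> [irr tr _]; split.
  rewrite /best; case: pickP => // z /forallP vmax [<-] y.
  have /andP[-> tie] := vmax y; split=> // /eqP eqv nyx.
  by move: tie; rewrite eqv nyx.
move=> vmax; rewrite /best; case: pickP => [z /forallP zmax|/(_ x)/negP[]].
  (* Two distinct tied maximizers would each be preferred to the other, against irreflexivity and
     transitivity. *)
  congr Some; apply/eqP; apply: contraT => nzx.
  have [le_zx tie] := vmax z; have /andP[le_xz tie'] := zmax x.
  have eqv : v z = v x by apply/eqP; rewrite eq_le le_zx.
  move: tie'; rewrite eqv eqxx eq_sym nzx /= => szx.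
  by have := tr _ _ _ szx (tie eqv nzx); rewrite irr.
apply/forallP => y; have [-> tie] := vmax y.
by apply/implyP => /andP[/eqP eqv nyx]; apply: tie.
Qed.

Lemma best_lt_max (P : finType) (succ : rel P) (d : Order.disp_t)
    (T : orderType d) (v : P -> T) (x : P) :
  strict_linear_order succ -> (forall y, y != x -> (v y < v x)%O) ->
  best succ v = Some x.
Proof.
move=> lin vmax; apply/best_SomeP => // y; have [->|nyx] := eqVneq y x.
  by split.
have ltv := vmax y nyx; split; first exact: ltW.
by move=> eqv; rewrite eqv ltxx in ltv.
Qed.

(** * Committees that give every seat to one party *)

Definition block (P : finType) (x : P) (l : nat) : multiset P :=
  [ffun y => if y == x then l else 0%N].

Lemma seats_block (P : finType) (x : P) (l : nat) (X : {set P}) :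
  seats (block x l) X = ((x \in X) * l)%N.
Proof.
rewrite /seats; under eq_bigr do rewrite ffunE.
rewrite -big_mkcondr /=; have [xX|nxX] := boolP (x \in X).
  rewrite (big_pred1 x) ?mul1n // => y.
  by rewrite /=; case: eqVneq => [->|]; rewrite ?xX ?andbF.
rewrite big_pred0 // => y.
by case: eqVneq => [->|]; rewrite ?(negPf nxX) ?andbF.
Qed.

Lemma seats_add_seat (P : finType) (x : P) (W : multiset P) (X : {set P}) :
  seats (add_seat x W) X = (seats W X + (x \in X))%N.
Proof.
rewrite /seats; under eq_bigr do rewrite ffunE.
rewrite big_split -[X in (_ + X)%N]muln1 -seats_block; congr addn.
by apply: eq_bigr => y _; rewrite ffunE; case: eqP.
Qed.

Lemma assign_seats_step (P : finType) (succ : rel P) (d : Order.disp_t)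
    (T : orderType d) (priority : multiset P -> P -> T) (x z : P) (k : nat) :
  assign_seats succ priority k = block x k ->
  best succ (priority (block x k)) = Some z ->
  assign_seats succ priority k.+1 = add_seat z (block x k).
Proof. by rewrite /assign_seats /= => -> ->. Qed.

Lemma AV_block (P : finType) (succ : rel P) (n : nat) (A : profile P n)
    (k : nat) (x : P) :
  best succ (fun y => #|supporters A [set: 'I_n] y|) = Some x ->
  AV succ A k = block x k.
Proof.
move=> bx; rewrite /AV bx; apply/ffunP => y; rewrite !ffunE.
by rewrite (inj_eq Some_inj) eq_sym.
Qed.

Lemma assign_seats_block (P : finType) (succ : rel P) (d : Order.disp_t)
    (T : orderType d) (priority : multiset P -> P -> T) (x : P) (k : nat) :
  (forall l, (l < k)%N -> best succ (priority (block x l)) = Some x) ->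
  assign_seats succ priority k = block x k.
Proof.
rewrite /assign_seats; elim: k => [|k IHk] bx /=.
  by apply/ffunP => y; rewrite !ffunE if_same.
rewrite IHk => [|l ltlk]; last exact/bx/ltnW.
rewrite bx //; apply/ffunP => y; rewrite !ffunE.
by case: eqVneq; rewrite ?addn1.
Qed.

(** This one count drives both families. Once [x] holds all seats, these are the supporters of [y]
    whose next seat has full Thiele weight; in portioning, it is the support of [y] left after [x]
    is picked in the first round. *)
Definition uncovered (P : finType) (n : nat) (A : profile P n) (x y : P) : nat :=
  #|supporters A ([set: 'I_n] :\: supporters A [set: 'I_n] x) y|.

(** * Marginal scores of sequential Thiele rules *)

Lemma card_supporters_sum (P : finType) (n : nat) (A : profile P n) (y : P) :
  #|supporters A [set: 'I_n] y| = (\sum_i (y \in val (A i)))%N.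
Proof.
rewrite -sum1dep_card big_mkcond; apply: eq_bigr => i _.
by rewrite in_setT /=; case: (y \in _).
Qed.

Lemma uncovered_sum (P : finType) (n : nat) (A : profile P n) (x y : P) :
  uncovered A x y = (\sum_i ((y \in val (A i)) && (x \notin val (A i))))%N.
Proof.
rewrite /uncovered -sum1dep_card big_mkcond; apply: eq_bigr => i _.
by rewrite !inE /= andbT; case: (x \in _); case: (y \in _).
Qed.

(** A supporter of [y] who also approves [x] already has [l] seats and adds [w l.+1]; one who does
    not has none and adds [w 1]. *)
Lemma thiele_marginal (R : realType) (w : nat -> R) (P : finType) (n : nat)
    (A : profile P n) (x y : P) (l : nat) :
  w 1%N = 1 ->
  thiele_score w A (add_seat y (block x l)) - thiele_score w A (block x l) =
  (uncovered A x y)%:R +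
  w l.+1 * (#|supporters A [set: 'I_n] y|%:R - (uncovered A x y)%:R).
Proof.
move=> w1; rewrite card_supporters_sum uncovered_sum !natr_sum -sumrB -sumrB.
rewrite mulr_sumr -big_split; apply: eq_bigr => i _ /=.
rewrite seats_add_seat seats_block.
case: (y \in _); rewrite /= ?addn0 ?subrr ?mulr0 ?addr0 //.
rewrite addn1 big_nat_recr //= [X in X - _]addrC addrK.
by case: (x \in _); rewrite ?mul1n ?mul0n ?subrr ?subr0 ?w1 ?mulr1 ?mulr0
  ?add0r ?addr0.
Qed.

(** With undiscounted weights the marginal score is the number of supporters, so every round repeats
    the choice of [AV], ties included. *)
Lemma seq_thiele_AV (R : realType) (w : nat -> R) (P : finType)
    (succ : rel P) (n : nat) (A : profile P n) (k : nat) :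
  strict_linear_order succ -> (0 < #|P|)%N ->
  w 1%N = 1 -> (forall l, (l < k)%N -> w l.+1 = 1) ->
  seq_thiele w succ A k = AV succ A k.
Proof.
move=> lin P0 w1 wk.
have [x bx] := best_Some (fun x => #|supporters A setT x|) lin P0.
rewrite (AV_block k bx); apply: assign_seats_block => l ltlk.
apply/best_SomeP => // y; have [ley tie] := (best_SomeP _ _ lin).1 bx y.
rewrite !thiele_marginal // wk // !mul1r !subrKC ler_nat; split=> //.
by move/eqP; rewrite eqr_nat => /eqP.
Qed.

(** * Weights computed by majoritarian portioning *)

Lemma portioning_rounds_le (P : finType) (succ : rel P) (n : nat)
    (A : profile P n) (t : nat) (V : {set 'I_n}) (wt : {ffun P -> nat}) (y : P) :
  (portioning_rounds succ A t V wt y <= maxn (wt y) #|supporters A V y|)%N.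
Proof.
elim: t V wt => [|t IHt] V wt /=; first exact: leq_maxl.
case: ifP => _; first exact: leq_maxl.
case: best => [x|]; last exact: leq_maxl.
apply: leq_trans (IHt _ _) _; rewrite geq_max ffunE; apply/andP; split.
  by case: eqVneq => [->|_]; rewrite ?leq_maxr ?leq_maxl.
apply: leq_trans (leq_maxr _ _); apply/subset_leq_card/subsetP => i.
by rewrite !inE => /andP[/andP[_ ->] ->].
Qed.

(** While a voter remains, its non-empty ballot gives some party a positive count, so [x] is never
    picked and its weight is never overwritten. *)
Lemma portioning_rounds_covered (P : finType) (succ : rel P) (n : nat)
    (A : profile P n) (t : nat) (V : {set 'I_n}) (wt : {ffun P -> nat}) (x : P) :
  strict_linear_order succ -> supporters A V x = set0 ->
  portioning_rounds succ A t V wt x = wt x.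
Proof.
move=> lin; elim: t V wt => //= t IHt V wt Sx; case: eqVneq => // V0.
case bz: best => [z|] //; rewrite IHt.
  rewrite ffunE; case: eqVneq => // xz; rewrite -xz in bz.
  have /set0Pn[i iV] := V0; have /set0Pn[y yA] := valP (A i).
  have [+ _] := (best_SomeP _ _ lin).1 bz y.
  rewrite Sx cards0 leEnat leqn0 cards_eq0 => /eqP/setP/(_ i).
  by rewrite !inE iV yA.
apply/setP => i; have /setP/(_ i) := Sx; rewrite !inE.
by case: (i \in V) => //=; rewrite ?andbF // => ->; rewrite andbF.
Qed.

(** The round removes all supporters of the winner, so no later round changes its weight. *)
Lemma portioning_rounds_best (P : finType) (succ : rel P) (n : nat)
    (A : profile P n) (t : nat) (V : {set 'I_n}) (wt : {ffun P -> nat}) (x : P) :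
  strict_linear_order succ ->
  best succ (fun y => #|supporters A V y|) = Some x -> V != set0 ->
  portioning_rounds succ A t.+1 V wt x = #|supporters A V x|.
Proof.
move=> lin bx V0 /=; rewrite (negPf V0) bx portioning_rounds_covered //.
  by rewrite ffunE eqxx.
apply/setP => i; rewrite !inE; case: (i \in V); rewrite /= ?andbF //.
by rewrite andbT andNb.
Qed.

Section Portioning.
Variables (P : finType) (succ : rel P) (n : nat) (A : profile P n.+1) (x : P).
Hypothesis lin : strict_linear_order succ.
Hypothesis bx : best succ (fun y => #|supporters A [set: 'I_n.+1] y|) = Some x.

Let setT_neq0 : [set: 'I_n.+1] != set0.
Proof. by apply/set0Pn; exists ord0. Qed.

Lemma portioning_winner :
  majoritarian_portioning succ A x = #|supporters A [set: 'I_n.+1] x|.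
Proof. exact: portioning_rounds_best. Qed.

Lemma portioning_le_supporters (y : P) :
  (majoritarian_portioning succ A y <= #|supporters A [set: 'I_n.+1] y|)%N.
Proof.
by apply: leq_trans (portioning_rounds_le _ _ _ _ _ _) _; rewrite ffunE max0n.
Qed.

Lemma portioning_le_uncovered (y : P) :
  y != x -> (majoritarian_portioning succ A y <= uncovered A x y)%N.
Proof.
move=> nyx; rewrite /majoritarian_portioning /= (negPf setT_neq0) bx.
apply: leq_trans (portioning_rounds_le _ _ _ _ _ _) _.
by rewrite !ffunE (negPf nyx) max0n.
Qed.

End Portioning.

(** The second round sees only voters outside the support of [x], and its winner keeps its count.
    The form [n.+2] guarantees that two rounds are available. *)
Lemma portioning_runner_up (P : finType) (succ : rel P) (n : nat)
    (A : profile P n.+2) (x y : P) :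
  strict_linear_order succ ->
  best succ (fun z => #|supporters A [set: 'I_n.+2] z|) = Some x ->
  best succ (uncovered A x) = Some y -> (0 < uncovered A x y)%N ->
  majoritarian_portioning succ A y = uncovered A x y.
Proof.
move=> lin bx by_ D0; rewrite /majoritarian_portioning.
have T0 : [set: 'I_n.+2] != set0 by apply/set0Pn; exists ord0.
rewrite [portioning_rounds]lock /= -lock.
have -> wt : portioning_rounds succ A n.+2 setT wt =
    portioning_rounds succ A n.+1 (setT :\: supporters A setT x)
      [ffun z => if z == x then #|supporters A setT x| else wt z].
  by rewrite {1}/portioning_rounds -/portioning_rounds (negPf T0) bx.
rewrite portioning_rounds_best //.
have /card_gt0P[i] := D0; rewrite inE => /andP[iV _].
by apply/set0Pn; exists i.
Qed.

(** With a constant divisor the weights alone decide. The approval winner's weight is its full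
    support, and no other weight exceeds the support of its party. *)
Lemma majoritarian_divisor_AV (R : realType) (g : nat -> R) (P : finType)
    (succ : rel P) (n : nat) (A : profile P n.+1) (k : nat) :
  strict_linear_order succ -> (0 < #|P|)%N -> 0 < g 0%N ->
  (forall l, (l < k)%N -> g l = g 0%N) ->
  majoritarian_divisor g succ A k = AV succ A k.
Proof.
move=> lin P0 g0 gk.
have [x bx] := best_Some (fun x => #|supporters A setT x|) lin P0.
rewrite (AV_block k bx); apply: assign_seats_block => l ltlk.
apply/best_SomeP => // y; have [ley tie] := (best_SomeP _ _ lin).1 bx y.
(* Party [y] holds either [l] or no seats, and [g] agrees at both. *)
have -> : g (block x l y) = g 0%N.
  by rewrite ffunE; case: ifP => // _; apply: gk.
have -> : g (block x l x) = g 0%N by rewrite ffunE eqxx gk.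
have leN := portioning_le_supporters succ A y.
rewrite (portioning_winner lin bx) ler_pM2r ?invr_gt0 // ler_nat; split.
  exact: leq_trans leN ley.
(* A tie in weights forces a tie in support, because the support of [y] lies between its weight and
   the support of [x]. *)
move/(mulIf (invr_neq0 (lt0r_neq0 g0)))/eqP; rewrite eqr_nat => /eqP eqN.
by apply: tie; apply/eqP; rewrite eq_le ley -eqN.
Qed.

(** Voter [ord0] is the one who deviates. The default of [nth] is never reached. *)
Definition with_first (P : finType) (B : ballot P) (s : seq (ballot P))
    : profile P (size s).+1 :=
  [ffun i : 'I_(size s).+1 => nth B (B :: s) i].

Lemma with_first_eq (P : finType) (B C : ballot P) (s : seq (ballot P))
    (i : 'I_(size s).+1) :
  i != ord0 -> with_first B s i = with_first C s i.
Proof.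
rewrite !ffunE; case: i => -[|i] //= lti _.
exact: set_nth_default.
Qed.

Lemma sum_with_first (P : finType) (p : pred (ballot P)) (B : ballot P)
    (s : seq (ballot P)) :
  (\sum_i p (with_first B s i) = p B + count p s)%N.
Proof.
rewrite big_ord_recl ffunE /=; congr addn; rewrite -sum1_count [RHS]big_mkcond.
rewrite [RHS](big_nth B) big_mkord; apply: eq_bigr => i _; rewrite ffunE /=.
by case: (p _).
Qed.

(** * The three-party profiles and their vote counts *)

Section Manipulation.
Variables (P : finType) (x y a : P).
Hypotheses (nxy : x != y) (nxa : x != a) (nya : y != a).
Hypothesis cover : forall z : P, [|| z == x, z == y | z == a].

Let singleton_neq0 (z : P) : [set z] != set0.
Proof. by apply/set0Pn; exists z; rewrite set11. Qed.

Let pair_neq0 (z z' : P) : [set z; z'] != set0.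
Proof. by apply/set0Pn; exists z; rewrite !inE eqxx. Qed.

Let one (z : P) : ballot P := Sub [set z] (singleton_neq0 z).
Let two (z z' : P) : ballot P := Sub [set z; z'] (pair_neq0 z z').

Variable t : nat.

(** Only [t] ballots [{a}] occur here: the remaining one is the sincere ballot of the deviating
    voter. *)
Definition others : seq (ballot P) :=
  nseq t.+2 (two x y) ++ nseq t.+2 (two x a) ++ nseq t.+2 (one y)
  ++ nseq t (one a).

Definition sincere := with_first (one a) others.
Definition manipulated := with_first (one y) others.

Lemma supportersE (B : ballot P) (z : P) :
  #|supporters (with_first B others) [set: _] z| =
  ((z \in val B) + (((z == x) || (z == y)) * t.+2
   + ((z == x) || (z == a)) * t.+2 + (z == y) * t.+2 + (z == a) * t))%N.
Proof.
rewrite card_supporters_sum (sum_with_first (fun C => z \in val C)).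
by rewrite !count_cat !count_nseq /= !inE !addnA.
Qed.

Lemma uncoveredE (B : ballot P) (z' z : P) :
  uncovered (with_first B others) z' z =
  ((z \in val B) && (z' \notin val B)
   + ((((z == x) || (z == y)) && ~~ ((z' == x) || (z' == y))) * t.+2
   + (((z == x) || (z == a)) && ~~ ((z' == x) || (z' == a))) * t.+2
   + ((z == y) && (z' != y)) * t.+2 + ((z == a) && (z' != a)) * t))%N.
Proof.
rewrite uncovered_sum.
rewrite (sum_with_first (fun C => (z \in val C) && (z' \notin val C))).
by rewrite !count_cat !count_nseq /= !inE !addnA.
Qed.

Let distinctE := (eqxx, negbTE nxy, negbTE nxa, negbTE nya,
  etrans (eq_sym y x) (negbTE nxy), etrans (eq_sym a x) (negbTE nxa),
  etrans (eq_sym a y) (negbTE nya)).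

Variable succ : rel P.
Hypothesis lin : strict_linear_order succ.

Let tallyE := (supportersE, uncoveredE, in_set1, distinctE).

(** The counts are [2t + 4] for [x] and [y] and [2t + 3] for [a], so only the tie between [x] and
    [y] matters. *)
Lemma best_sincere :
  succ x y -> best succ (fun z => #|supporters sincere [set: _] z|) = Some x.
Proof.
move=> succ_xy; apply/best_SomeP => // z; rewrite leEnat /sincere.
by case/or3P: (cover z) => /eqP->; rewrite !tallyE /=; split=> //; lia.
Qed.

(** The extra ballot lifts [y] to [2t + 5], against [2t + 4] for [x] and [2t + 2] for [a]. *)
Lemma best_manipulated :
  best succ (fun z => #|supporters manipulated [set: _] z|) = Some y.
Proof.
apply: best_lt_max => // z; rewrite ltEnat /manipulated.
by case/or3P: (cover z) => /eqP->; rewrite !tallyE //= => _; lia.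
Qed.

(** Outside the support of [x], party [y] has [t + 2] voters and [a] has [t + 1]. *)
Lemma best_uncovered_sincere : best succ (uncovered sincere x) = Some y.
Proof.
apply: best_lt_max => // z; rewrite ltEnat /sincere.
by case/or3P: (cover z) => /eqP->; rewrite !tallyE //= => _; lia.
Qed.

(** Outside the support of [y], party [a] has [2t + 2] voters and [x] has [t + 2]; these would tie
    at [t = 0]. *)
Lemma best_uncovered_manipulated :
  (0 < t)%N -> best succ (uncovered manipulated y) = Some a.
Proof.
move=> t0; apply: best_lt_max => // z; rewrite ltEnat /manipulated.
by case/or3P: (cover z) => /eqP->; rewrite !tallyE //= => _; lia.
Qed.

Lemma seats_sincere (k : nat) (z : P) :
  z != a -> seats (add_seat z (block x k)) [set a] = 0%N.
Proof.
move=> nza.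
by rewrite seats_add_seat seats_block !in_set1 (negPf nxa) (negPf nza).
Qed.

Lemma seats_manipulated (k : nat) :
  (0 < seats (add_seat a (block y k)) [set a])%N.
Proof. by rewrite seats_add_seat set11 addn1. Qed.

Variable R : realType.

(** * The first discounted seat under a sequential Thiele rule *)

Section Thiele.
Variables (w : nat -> R) (k : nat).
Hypothesis w1 : w 1%N = 1.
Hypothesis w_lt : forall l, (l < k)%N -> w l.+1 = 1.

Let P_gt0 : (0 < #|P|)%N.
Proof. by apply/card_gt0P; exists x. Qed.

(** Both [y] and [a] share [t + 2] voters with [x], so their discounted terms agree and [y] leads by
    exactly 1. Hence [a] is not chosen, whichever of [x] and [y] wins the seat. *)
Lemma thiele_sincere :
  succ x y -> seats (seq_thiele w succ sincere k.+1) [set a] = 0%N.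
Proof.
move=> /best_sincere bx.
have first_rounds := seq_thiele_AV sincere lin P_gt0 w1 w_lt.
rewrite (AV_block k bx) in first_rounds.
pose v z := thiele_score w sincere (add_seat z (block x k))
            - thiele_score w sincere (block x k).
have [z bz] := best_Some v lin P_gt0.
rewrite /seq_thiele (assign_seats_step first_rounds bz) seats_sincere //.
apply: contraTneq isT => za; rewrite {z}za in bz.
have [+ _] := (best_SomeP _ _ lin).1 bz y.
rewrite /v !thiele_marginal // /sincere !tallyE !(mul0n, mul1n, add0n, addn0).
rewrite -[t.+2]addn2 !natrD /=; lra.
Qed.

(** No voter approves both [y] and [a], so [a] scores an undiscounted [2t + 2]. With [c = w k.+1],
    party [x] scores [(1 + c)(t + 2)] and [y] scores [c (2t + 5)]; both are smaller once
    [c (t + 2) < t] and [c < 1]. *)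
Lemma thiele_manipulated :
  w k.+1 < 1 -> w k.+1 * t.+2%:R < t%:R ->
  (0 < seats (seq_thiele w succ manipulated k.+1) [set a])%N.
Proof.
move=> w_lt1 discount.
have first_rounds := seq_thiele_AV manipulated lin P_gt0 w1 w_lt.
rewrite (AV_block k best_manipulated) in first_rounds.
rewrite /seq_thiele (assign_seats_step first_rounds (z := a)).
  exact: seats_manipulated.
apply: best_lt_max => // z; rewrite !thiele_marginal // /manipulated.
case/or3P: (cover z) => /eqP->; rewrite !tallyE //
  !(mul0n, mul1n, add0n, addn0) => _.
  by move: discount; rewrite -[t.+2]addn2 !natrD; lra.
by move: w_lt1 discount; rewrite -[t.+2]addn2 !natrD /=; lra.
Qed.
End Thiele.

(** * The first discounted seat under a divisor method *)

Section Divisor.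
Variables (g : nat -> R) (k : nat).
Hypothesis g_gt0 : forall l, 0 < g l.
Hypothesis g_lt : forall l, (l < k)%N -> g l = g 0%N.

Let P_gt0 : (0 < #|P|)%N.
Proof. by apply/card_gt0P; exists x. Qed.

(** Neither [y] nor [a] holds a seat, so both are divided by [g 0] and the weight [t + 2] of [y]
    beats the weight of [a], at most [t + 1]. *)
Lemma divisor_sincere :
  succ x y -> seats (majoritarian_divisor g succ sincere k.+1) [set a] = 0%N.
Proof.
move=> /best_sincere bx.
have first_rounds := majoritarian_divisor_AV sincere lin P_gt0 (g_gt0 0) g_lt.
rewrite (AV_block k bx) in first_rounds.
pose v z := (majoritarian_portioning succ sincere z)%:R / g (block x k z).
have [z bz] := best_Some v lin P_gt0.
rewrite /majoritarian_divisor (assign_seats_step first_rounds bz).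
rewrite seats_sincere //.
apply: contraTneq isT => za; rewrite {z}za in bz.
have [+ _] := (best_SomeP _ _ lin).1 bz y.
rewrite /v !ffunE !distinctE ler_pM2r ?invr_gt0 // ler_nat.
rewrite (portioning_runner_up lin bx best_uncovered_sincere);
  last by rewrite !tallyE.
move=> le_ya; have := leq_trans le_ya (portioning_le_uncovered bx _).
rewrite eq_sym => /(_ nxa); rewrite !tallyE /=; lia.
Qed.

(** The ratio [g 0 / g k] acts as the discount [c]: [a] with weight [2t + 2] beats [y] because
    [c (2t + 5) < 2t + 2], and beats [x] because the weight of [x] is at most [t + 2]. *)
Lemma divisor_manipulated :
  g 0%N < g k -> g 0%N / g k * t.+2%:R < t%:R ->
  (0 < seats (majoritarian_divisor g succ manipulated k.+1) [set a])%N.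
Proof.
move=> g_jump discount.
have t0 : (0 < t)%N.
  rewrite -(ltr_nat R); apply: le_lt_trans discount.
  by rewrite mulr_ge0 ?ler0n // divr_ge0 // ltW.
have first_rounds :=
  majoritarian_divisor_AV manipulated lin P_gt0 (g_gt0 0) g_lt.
rewrite (AV_block k best_manipulated) in first_rounds.
rewrite /majoritarian_divisor (assign_seats_step first_rounds (z := a)).
  exact: seats_manipulated.
apply: best_lt_max => // z; rewrite !ffunE.
have ba := best_uncovered_manipulated t0.
rewrite (portioning_runner_up lin best_manipulated ba); last by rewrite !tallyE.
case/or3P: (cover z) => /eqP->; rewrite !distinctE //= => _.
  rewrite ltr_pM2r ?invr_gt0 // ltr_nat.
  apply: leq_ltn_trans (portioning_le_uncovered best_manipulated nxy) _.
  by rewrite /manipulated !tallyE /=; lia.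
rewrite (portioning_winner lin best_manipulated) ltr_pdivlMr // mulrAC -mulrA.
have ratio_lt1 : g 0%N / g k < 1 by rewrite ltr_pdivrMr // mul1r.
move: discount; rewrite /manipulated !tallyE !(mul0n, mul1n, add0n, addn0).
by rewrite -[t.+2]addn2 !natrD /=; lra.
Qed.
End Divisor.
End Manipulation.

(** * From the profiles to a failure of strategyproofness *)

Lemma not_sp_unrepresented (f : rule) (k m n : nat) (A A' : profile 'I_m n)
    (i : 'I_n) (X : {set 'I_m}) :
  (forall j : 'I_n, j != i -> A j = A' j) -> val (A i) = X ->
  seats (f m n A k) X = 0%N -> (0 < seats (f m n A' k) X)%N ->
  ~ sp_unrepresented f k m n.
Proof.
by move=> eqA <- f0 f_gt0 /(_ A A' i eqA f0); rewrite f0 leqNgt f_gt0.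
Qed.

Lemma manipulation_violates_sp (f : rule) (k m : nat) (x y a : 'I_m) (t : nat) :
  seats (f m _ (sincere x y a t) k) [set a] = 0%N ->
  (0 < seats (f m _ (manipulated x y a t) k) [set a])%N ->
  exists n : nat, (1 <= n)%N /\ ~ sp_unrepresented f k m n.
Proof.
move=> f0 f_gt0; exists (size (others x y a t)).+1; split=> //.
apply: not_sp_unrepresented f0 f_gt0 => [j|]; first exact: with_first_eq.
by rewrite ffunE.
Qed.

Lemma discount_scale (R : realType) (c : R) :
  c < 1 -> exists t : nat, c * t.+2%:R < t%:R.
Proof.
move=> c1; have d0 : 0 < 1 - c by rewrite subr_gt0.
(* The goal rearranges to [2c / (1 - c) < t]. *)
exists (Num.truncn (c *+ 2 / (1 - c))).+1.
have := truncnS_gt (c *+ 2 / (1 - c)).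
rewrite ltr_pdivrMr //; set t := (Num.truncn _).+1.
rewrite -[t.+2]addn2 natrD; lra.
Qed.

(** Of two chosen parties the preferred one is called [x], the other [y]; the third serves as
    [a]. *)
Lemma three_parties (succ : rel 'I_3) :
  strict_linear_order succ ->
  exists x y a : 'I_3, [/\ succ x y, x != y, x != a, y != a &
    forall z, [|| z == x, z == y | z == a]].
Proof.
case=> _ _ tot; pose p : 'I_3 := inord 0; pose q : 'I_3 := inord 1.
have npq : p != q by rewrite -val_eqE /= !inordK.
have cover z : [|| z == p, z == q | z == ord_max].
  by rewrite -!val_eqE /= !inordK //; case: z => -[|[|[|]]].
have npm : p != ord_max by rewrite -val_eqE /= !inordK.
have nqm : q != ord_max by rewrite -val_eqE /= !inordK.
case/orP: (tot p q npq) => spq; [exists p, q|exists q, p]; exists ord_max;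
  split=> //; rewrite 1?eq_sym // => z.
by rewrite orbCA.
Qed.

Theorem theorem4 (R : realType) (succ : forall m : nat, rel 'I_m)
    (succ_linear : forall m : nat, strict_linear_order (succ m)) :
  (forall w : nat -> R, thiele_weights w ->
     ~ coincide (fun m n A k => seq_thiele w (succ m) A k)
                (fun m n A k => AV (succ m) A k) ->
     exists k m n : nat,
       [/\ (1 <= k)%N, (1 <= m)%N, (1 <= n)%N &
           ~ sp_unrepresented (fun m n A k => seq_thiele w (succ m) A k)
               k m n])
  /\
  (forall g : nat -> R, divisor_function g ->
     ~ coincide (fun m n A k => majoritarian_divisor g (succ m) A k)
                (fun m n A k => AV (succ m) A k) ->
     exists k m n : nat,
       [/\ (1 <= k)%N, (1 <= m)%N, (1 <= n)%N &
           ~ sp_unrepresented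
               (fun m n A k => majoritarian_divisor g (succ m) A k)
               k m n]).
Proof.
have [x [y [a [sxy nxy nxa nya cover]]]] := three_parties (succ_linear 3).
split.
- move=> w [w1 _ w_decr] nAV.
  have : exists l, w l.+1 != 1.
    apply: contrapT => /forallNP w_const; apply: nAV => m n k m0 _ _ A.
    apply: (seq_thiele_AV A (succ_linear m)); rewrite ?card_ord // => l _.
    by apply/eqP/negPn/negP/w_const.
  (* Minimality of [k] makes the first [k] rounds agree with [AV], so [k.+1] seats expose the first
     discount. *)
  case/ex_minnP=> k wk_neq1 k_min.
  have wk_lt1 : w k.+1 < 1 by rewrite lt_neqAle wk_neq1 -w1 w_decr.
  have w_const l : (l < k)%N -> w l.+1 = 1.
    by apply: contraTeq => /k_min; rewrite -leqNgt.
  have [t ht] := discount_scale wk_lt1.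
  have [n [n0 nsp]] := manipulation_violates_sp
    (f := fun m n A k => seq_thiele w (succ m) A k)
    (thiele_sincere nxy nxa nya cover t (succ_linear 3)
       w1 w_const sxy)
    (thiele_manipulated nxy nxa nya cover (succ_linear 3)
       w1 w_const wk_lt1 ht).
  by exists k.+1, 3%N, n.
move=> g [g_gt0 g_incr] nAV.
have : exists l, g l != g 0%N.
  apply: contrapT => /forallNP g_const; apply: nAV => m [//|n] k m0 _ _ A.
  apply: (majoritarian_divisor_AV A (succ_linear m));
    rewrite ?card_ord // => l _.
  by apply/eqP/negPn/negP/g_const.
(* Here [k] is the least seat count at which the divisor leaves [g 0]; monotonicity makes it larger
   there. *)
case/ex_minnP=> k gk_neq k_min.
have g_jump : g 0%N < g k by rewrite lt_neqAle eq_sym gk_neq g_incr.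
have g_const l : (l < k)%N -> g l = g 0%N.
  by apply: contraTeq => /k_min; rewrite -leqNgt.
have ratio_lt1 : g 0%N / g k < 1 by rewrite ltr_pdivrMr ?mul1r.
have [t ht] := discount_scale ratio_lt1.
have [n [n0 nsp]] := manipulation_violates_sp
  (f := fun m n A k => majoritarian_divisor g (succ m) A k)
  (divisor_sincere nxy nxa nya cover t (succ_linear 3)
     g_gt0 g_const sxy)
  (divisor_manipulated nxy nxa nya cover (succ_linear 3)
     g_gt0 g_const g_jump ht).
by exists k.+1, 3%N, n.
Qed.
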